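(* Let $E/K$ be a Galois extension of number fields with group $G=G(E/K)$, $A=\mathfrak o_K$, $B=\mathfrak o_E$, $C(X)\in A[X]$ monic of degree $d\ge2$ with simple roots $x_1,\dots,x_d$ and splitting field $E$, and discriminant $\Delta=\Delta_C$. For $s\in G$ let $$\Psi_s(X)=\sum_{i=1}^d\frac{C(X)}{X-x_i}\,\frac{s(x_i)}{C'(x_i)}=\sum_{k=0}^{d-1}\Psi_k(s)X^k.$$ For a conjugacy class $\Lambda$ of $G$ with $\lambda=\mathrm{card}(\Lambda)$ and $0\le k\le d-1$, set $\Omega_{\Lambda;k}(R)=\prod_{s\in\Lambda}(R-\Psi_k(s))$. Then for every conjugacy class $\Lambda$ and every $0\le k\le d-1$: 1. $\Omega_{\Lambda;k}(R)$ has degree $\lambda$ and coefficients in $A[\frac1\Delta]$; more precisely $\Delta^\lambda\Omega_{\Lambda;k}(R)\in A[R]$. 2. As an element of $K[R]$, $\Omega_{\Lambda;k}(R)$ is either irreducible or a power of an irreducible polynomial. 3. For every $\mathcal P\in\mathbb P(\Lambda)$, with $p=N(\mathcal P)$, writing the remainder of the Euclidean division of $X^p$ by $C(X)$ as $R_p(X)=\sum_{k=0}^{d-1}r_k(p)X^k$ (so that $U_p=\sum_{k=0}^{d-1}r_k(p)U_k$ for every sequence of class $C$ in $A$), one has $$\Delta^\lambda\,\Omega_{\Lambda;k}(r_k(p))\equiv0\pmod{\mathcal P}.$$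
   Context: $N(\mathcal P)=|A/\mathcal P|$. $\mathbb P(\Lambda)$ is the set of nonzero prime ideals $\mathcal P$ of $A$ not ramified in $B$ (i.e. $\Delta\notin\mathcal P$) for which there is a prime $Q$ of $B$ above $\mathcal P$ with Frobenius $\mathrm{Frob}_Q\in\Lambda$, where $\mathrm{Frob}_Q$ is characterized by $\mathrm{Frob}_Q(x)\equiv x^{N(\mathcal P)}\pmod Q$ for all $x\in B$. A sequence $(U_n)$ is of class $C$ in $A$ if all $U_n\in A$ and, writing $C(X)=c_0+\dots+c_{d-1}X^{d-1}+X^d$, $c_0U_n+\dots+c_{d-1}U_{n+d-1}+U_{n+d}=0$ for all $n$. *)

(* Defs.v *)
From HB Require Import structures.
From mathcomp Require Import all_boot all_order all_algebra all_fingroup.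
From mathcomp Require Import all_solvable all_field.
From mathcomp Require Import finmap boolp classical_sets cardinality.
From mathcomp Require Import ring_quotient.

Set Implicit Arguments.
Unset Strict Implicit.
Unset Printing Implicit Defensive.

Import GRing.Theory.
Local Open Scope ring_scope.

(* ringInt F is the integral closure of Z in F; for a number field F it is
   the ring of integers of F. *)
Definition alg_integer (F : fieldType) : pred F :=
  fun x => `[< integralOver (intr : int -> F) x >].
Arguments alg_integer : clear implicits.

Lemma alg_integer_subring_closed (F : fieldType) :
  subring_closed (alg_integer F).
Proof.
split=> [|x y /asboolP xZ /asboolP yZ|x y /asboolP xZ /asboolP yZ];
  apply/asboolP.
- exact: integral1.
- exact: integral_sub.
- exact: integral_mul.
Qed.

HB.instance Definition _ (F : fieldType) :=
  GRing.isSubringClosed.Build F (alg_integer F)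
    (@alg_integer_subring_closed F).

Record ringInt (F : fieldType) :=
  RingInt { ringInt_val :> F; _ : ringInt_val \in alg_integer F }.

HB.instance Definition _ (F : fieldType) := [isSub for @ringInt_val F].
HB.instance Definition _ (F : fieldType) := [Choice of ringInt F by <:].
HB.instance Definition _ (F : fieldType) :=
  [SubChoice_isSubComNzRing of ringInt F by <:].

Lemma ringInt_map_subproof (F L : fieldType) (f : {rmorphism F -> L})
  (a : ringInt F) : f (val a) \in alg_integer L.
Proof.
case: a => a /= /asboolP[p mp rp]; apply/asboolP; exists p => //.
suff -> : map_poly intr p = map_poly f (map_poly intr p) by rewrite rmorph_root.
by rewrite -map_poly_comp; apply: eq_map_poly => z /=; rewrite rmorph_int.
Qed.

Definition ringInt_map (F L : fieldType) (f : {rmorphism F -> L})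
  (a : ringInt F) : ringInt L := RingInt (ringInt_map_subproof f a).

Definition discriminant (R : comNzRingType) (p : {poly R}) : R :=
  (-1) ^+ 'C((size p).-1, 2) * resultant p p^`().

(* N(P) = |R/P|; fset_set returns the empty set when R/P is infinite. *)
Definition ideal_norm (R : comNzRingType) (P : prime_idealr R) : nat :=
  #|` fset_set [set: {ideal_quot P}]|%fset.

Definition class_seq (R : comNzRingType) (C : {poly R}) (U : nat -> R) : Prop :=
  forall n, \sum_(j < size C) C`_j * U (n + j)%N = 0.

Section GaloisSetting.

Variables (K : fieldExtType rat) (E : splittingFieldType K).

Notation A := (ringInt K).
Notation B := (ringInt E).

Definition incl (a : A) : B := ringInt_map (in_alg E) a.

Definition inclE (a : A) : E := val (incl a).

Definition gal_ringInt (s : gal_of {:E}) (b : B) : B :=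
  ringInt_map (gal_repr s) b.

Definition lies_above (Q : prime_idealr B) (P : prime_idealr A) : Prop :=
  forall a : A, (incl a \in Q) = (a \in P).

Definition is_Frobenius (P : prime_idealr A) (Q : prime_idealr B)
    (s : gal_of {:E}) : Prop :=
  forall b : B, gal_ringInt s b - b ^+ ideal_norm P \in Q.

Definition Frob_primes (C : {poly A}) (Lambda : {set gal_of {:E}})
    (P : prime_idealr A) : Prop :=
  [/\ exists2 a : A, a \in P & a != 0,
      discriminant C \notin P &
      exists Q : prime_idealr B, lies_above Q P /\
        exists2 s, s \in Lambda & is_Frobenius P Q s].

Definition Psi (d : nat) (C : {poly A}) (x : 'I_d -> E) (s : gal_of {:E}) :
    {poly E} :=
  let CE := map_poly inclE C in
  \sum_(i < d) (s (x i) / CE^`().[x i]) *: (CE %/ ('X - (x i)%:P)).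

Definition Omega (d : nat) (C : {poly A}) (x : 'I_d -> E)
    (Lambda : {set gal_of {:E}}) (k : nat) : {poly E} :=
  \prod_(s in Lambda) ('X - ((Psi C x s)`_k)%:P).

(* y lies in the subring A[1/delta] of E. *)
Definition in_adjoin_inv (delta : A) (y : E) : Prop :=
  exists q : {poly A}, y = (map_poly inclE q).[(inclE delta)^-1].

End GaloisSetting.

(* Main.v *)
Require Import Defs.
From HB Require Import structures.
From mathcomp Require Import all_boot all_order all_algebra all_fingroup.
From mathcomp Require Import all_solvable all_field.
From mathcomp Require Import ring_quotient.
From mathcomp Require Import boolp.

(* By Lagrange interpolation, [Psi_s] is the polynomial of degree less than [d]
   taking the value [s (x i)] at each root [x i] of [C], and the remainder [R_p]
   of [X^p] takes the value [x i ^ p] there.  Bezout for the resultant makes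
   [Delta / C'(x i)] an algebraic integer, so [Delta * Psi_k(s)] is integral.
   The Galois group acts by [t (Psi_k(s)) = Psi_k(t s t^-1)]; hence it fixes
   [Omega], and all roots of [Omega] are conjugate, so they share a single
   minimal polynomial.  If [s] is the Frobenius at [Q], then
   [s (x i) = x i ^ p] modulo [Q], which makes the factor
   [Delta * r_k(p) - Delta * Psi_k(s)] of [Delta^lambda * Omega (r_k(p))]
   vanish modulo [Q]. *)

Import GRing.Theory.
Local Open Scope ring_scope.

(* The library's [map_resultant] requires the source ring to be [{poly _}]. *)
Lemma rmorph_resultant (aR rR : nzRingType) (f : {rmorphism aR -> rR})
    (p q : {poly aR}) :
    f (lead_coef p) != 0 -> f (lead_coef q) != 0 ->
  f (resultant p q) = resultant (map_poly f p) (map_poly f q).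
Proof.
move=> fp0 fq0; rewrite -[LHS]det_map_mx /resultant /Sylvester_mx.
rewrite !size_map_poly_id0 //; congr (\det _); apply/matrixP => i j.
rewrite !mxE; case: splitP => k _; rewrite !mxE /= !rVpoly_delta !coefXnM;
  by case: ifP => _; rewrite ?rmorph0 ?coef_map.
Qed.

(** At the roots of [C] this is [C / (X - x i)], the unnormalized Lagrange basis polynomial.
    Allowing any commutative ring makes it available over [ringInt E], where its coefficients are
    integral by construction. *)
Definition nodal (R : comNzRingType) (d : nat) (x : 'I_d -> R) (i : 'I_d) :
    {poly R} :=
  \prod_(j < d | j != i) ('X - (x j)%:P).
Arguments nodal {R d} x i.

Lemma map_nodal (R S : comNzRingType) (f : {rmorphism R -> S}) (d : nat)
    (x : 'I_d -> R) (i : 'I_d) :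
  map_poly f (nodal x i) = nodal (f \o x) i.
Proof.
by rewrite rmorph_prod /=; apply: eq_bigr => j _; rewrite map_polyXsubC.
Qed.

Lemma nodal_perm (R : comNzRingType) (d : nat) (x : 'I_d -> R)
    (g : 'I_d -> 'I_d) (i : 'I_d) :
  injective g -> nodal (x \o g) i = nodal x (g i).
Proof.
move=> injg; rewrite /nodal [RHS](reindex g) /=; last first.
  by apply: onW_bij; apply: injF_bij.
by apply: eq_bigl => j; rewrite (inj_eq injg).
Qed.

(** * Lagrange interpolation at distinct nodes *)

Section Lagrange.

Variables (F : fieldType) (d : nat) (x : 'I_d -> F).
Let N : {poly F} := \prod_(i < d) ('X - (x i)%:P).

Lemma prod_XsubC_nodal i : N = nodal x i * ('X - (x i)%:P).
Proof. by rewrite /N (bigD1 i) //= mulrC. Qed.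

Lemma divp_nodal i : N %/ ('X - (x i)%:P) = nodal x i.
Proof. by rewrite (prod_XsubC_nodal i) mulpK ?polyXsubC_eq0. Qed.

Lemma deriv_prod_XsubC i : N^`().[x i] = (nodal x i).[x i].
Proof.
by rewrite (prod_XsubC_nodal i) derivM derivXsubC !hornerE subrr mulr0 add0r.
Qed.

Hypothesis injx : injective x.

Lemma nodal_neq0 i : (nodal x i).[x i] != 0.
Proof.
rewrite horner_prod; apply/prodf_neq0 => j ji.
by rewrite !hornerE subr_eq0 (inj_eq injx) eq_sym.
Qed.

Lemma nodal_root i j : j != i -> (nodal x i).[x j] = 0.
Proof.
by move=> ji; rewrite horner_prod (bigD1 j) //= !hornerE subrr mul0r.
Qed.

Lemma size_nodal i : size (nodal x i) = d.
Proof.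
rewrite /nodal -(big_enum _ _ (predC1 i)) size_prod_XsubC.
rewrite -cardE cardC1 card_ord prednK //; exact: leq_ltn_trans (ltn_ord i).
Qed.

(** The difference of the two sides has size at most [d] and vanishes at [d] distinct points. *)
Lemma lagrange (p : {poly F}) : (size p <= d)%N ->
  p = \sum_(i < d) (p.[x i] / (nodal x i).[x i]) *: nodal x i.
Proof.
move=> sp; apply/eqP; rewrite -subr_eq0; apply/eqP.
apply: (@roots_geq_poly_eq0 _ _ [seq x i | i : 'I_d]).
- apply/allP => _ /mapP[i _ ->]; rewrite rootE hornerD hornerN horner_sum.
  rewrite (bigD1 i) //= big1 => [|j ji].
    by rewrite hornerZ divfK ?nodal_neq0 // addr0 subrr.
  by rewrite hornerZ (@nodal_root j i) 1?eq_sym // mulr0.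
- by rewrite map_inj_uniq // enum_uniq.
rewrite size_map size_enum_ord (leq_trans (size_polyD _ _)) // geq_max sp.
rewrite size_polyN (leq_trans (size_sum _ _ _)) //; apply/bigmax_leqP => i _.
by rewrite (leq_trans (size_scale_leq _ _)) ?size_nodal.
Qed.

End Lagrange.

(** * Linear recurrences and remainders modulo [C] *)

Section LinearRecurrence.

Variables (R : comNzRingType) (C : {poly R}).

(** The linear form [X^j -> U j] kills the ideal generated by [C]: multiplying by [X] amounts to
    shifting [U], and a shifted sequence is again of class [C]. Beyond [N0] the truncated sum misses
    no coefficient. *)
Lemma class_seq_mul (q : {poly R}) (U : nat -> R) : class_seq C U ->
  exists N0, forall N, (N0 <= N)%N -> \sum_(j < N) (q * C)`_j * U j = 0.
Proof.
have wid (V : nat -> R) f N : (size f <= N)%N ->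
    \sum_(j < N) f`_j * V j = \sum_(j < size f) f`_j * V j.
  move=> fN; rewrite [RHS](big_ord_widen _ (fun j => f`_j * V j) fN).
  rewrite [RHS]big_mkcond; apply: eq_bigr => j _; case: ltnP => // sj.
  by rewrite nth_default ?mul0r.
elim/poly_ind: q U => [|q c IH] U CU.
  by exists 0%N => N _; rewrite mul0r big1 // => j _; rewrite coef0 mul0r.
have /IH[N0 HN0] : class_seq C (U \o succn).
  by move=> n; rewrite -[RHS](CU n.+1); apply: eq_bigr.
exists (maxn N0.+1 (size C)) => -[|N]; first by rewrite geq_max.
rewrite geq_max => /andP[N0N CN].
under eq_bigr do rewrite mulrDl coefD mulrDl.
rewrite big_split /= [X in _ + X](_ : _ = 0) ?addr0; last first.
  under eq_bigr do rewrite coefCM -mulrA.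
  rewrite -mulr_sumr wid //.
  by rewrite (CU 0%N : \sum_(j < size C) C`_j * U j = 0) mulr0.
rewrite -mulrA ['X * C]mulrC mulrA big_ord_recl coefMX /= mul0r add0r.
by rewrite -[RHS](HN0 N) //; apply: eq_bigr => i _; rewrite coefMX.
Qed.

Lemma class_seq_rmodp (d p : nat) (U : nat -> R) :
    C \is monic -> size C = d.+1 -> class_seq C U ->
  U p = \sum_(j < d) (Pdiv.Ring.rmodp 'X^p C)`_j * U j.
Proof.
move=> mC sC CU; set r := Pdiv.Ring.rmodp _ _.
have [N0 HN0] := @class_seq_mul (Pdiv.Ring.rdivp 'X^p C) U CU.
have sr : (size r <= d)%N.
  by rewrite -ltnS -sC Pdiv.Ring.ltn_rmodp monic_neq0.
(* [N] is large enough for the multiple of [C], for [X^p] and for the remainder at once. *)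
pose N := maxn N0 (maxn p.+1 d).
have pN : (p < N)%N by rewrite /N !leq_max leqnn orbT.
have dN : (d <= N)%N by rewrite /N !leq_max leqnn !orbT.
have : \sum_(j < N) ('X^p)`_j * U j = U p.
  rewrite (bigD1 (Ordinal pN)) //= coefXn eqxx mul1r big1 ?addr0 // => j.
  by rewrite -val_eqE /= coefXn => /negPf->; rewrite mul0r.
move=> <-; rewrite {1}(Pdiv.RingMonic.rdivp_eq mC 'X^p) -/r.
under eq_bigr do rewrite coefD mulrDl.
rewrite big_split /= HN0 ?leq_maxl // add0r.
rewrite [RHS](big_ord_widen _ (fun j => r`_j * U j) dN).
rewrite [RHS]big_mkcond; apply: eq_bigr => j _; case: ltnP => // sj.
by rewrite nth_default ?mul0r // (leq_trans sr).
Qed.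

End LinearRecurrence.

(** A common root in [L] makes the gcd of [f] and [g] nonconstant, and gcds commute with field
    extension, so [f] divides [g]. Induction on the number of roots then treats the quotient. *)
Lemma power_of_irreducible (K L : fieldType) (h : {rmorphism K -> L})
    (f g : {poly K}) (s : seq L) :
    f \is monic -> irreducible_poly f ->
    map_poly h g = \prod_(a <- s) ('X - a%:P) ->
    {in s, forall a, root (map_poly h f) a} ->
  exists n, g = f ^+ n.
Proof.
move=> mf irrf; have [n] := ubnP (size s).
elim: n s g => // n IH [|a s] g sn gE fs.
  by exists 0%N; apply: (map_poly_inj h); rewrite gE big_nil expr0 rmorph1.
have mg : g \is monic by rewrite -(map_monic h) gE monic_prod_XsubC.
have fg : f %| g.
  case: irrf => sf irrf.
  have : gcdp f g %= f.
    apply: irrf (dvdp_gcdl _ _).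
    rewrite -(size_map_poly h) gcdp_map; apply/negP => co.
    have : root (gcdp (map_poly h f) (map_poly h g)) a.
      by rewrite root_gcd fs ?mem_head //= gE root_prod_XsubC mem_head.
    rewrite size_poly_eq1 in co.
    by rewrite (eqp_root co) (negPf (root1 _)).
  by move/eqp_dvdl <-; apply: dvdp_gcdr.
have [q gq] := dvdpP _ _ fg.
have mq : q \is monic by rewrite -(monicMr _ mf) -gq.
(* A divisor of a split polynomial splits over a subsequence of its roots, so the hypothesis on the
   roots is inherited. *)
have /dvdp_prod_XsubC[m] : map_poly h q %| \prod_(a <- a :: s) ('X - a%:P).
  by rewrite -gE gq rmorphM dvdp_mulr.
rewrite eqp_monic ?map_monic ?monic_prod_XsubC // => /eqP qm.
have [||k qk] := IH _ _ _ qm.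
- rewrite -ltnS (leq_trans _ sn) // ltnS.
  have := size_prod_XsubC (mask m (a :: s)) id; rewrite -qm size_map_poly => sq.
  have := size_prod_XsubC (a :: s) id; rewrite -gE size_map_poly gq.
  rewrite size_Mmonic ?monic_neq0 // sq addSn /= => sg; case: irrf => sf _.
  by rewrite -ltnS -sg -addn2 leq_add2l.
- by move=> b /mem_mask; apply: fs.
by exists k.+1; rewrite gq qk exprSr.
Qed.

(** * Algebraic integers and their transport along field morphisms *)

Fact ringInt_val_zmod_morphism (F : fieldType) :
  zmod_morphism (@ringInt_val F).
Proof. by []. Qed.

Fact ringInt_val_monoid_morphism (F : fieldType) :
  monoid_morphism (@ringInt_val F).
Proof. by []. Qed.

HB.instance Definition _ (F : fieldType) :=
  GRing.isZmodMorphism.Build (ringInt F) F (@ringInt_val F)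
    (@ringInt_val_zmod_morphism F).
HB.instance Definition _ (F : fieldType) :=
  GRing.isMonoidMorphism.Build (ringInt F) F (@ringInt_val F)
    (@ringInt_val_monoid_morphism F).

Lemma ringInt_poly_lift (F : fieldType) (p : {poly F}) :
    (forall j, p`_j \in alg_integer F) ->
  exists q : {poly ringInt F}, map_poly (@ringInt_val F) q = p.
Proof.
move=> intp; exists (\poly_(j < size p) RingInt (intp j)).
by apply/polyP => j; rewrite coef_map coef_poly /=; case: ltnP => // sj;
  rewrite nth_default.
Qed.

(** Transitivity of integrality. *)
Lemma alg_integer_root (F : fieldType) (p : {poly ringInt F}) (y : F) :
  p \is monic -> root (map_poly (@ringInt_val F) p) y -> y \in alg_integer F.
Proof.
move=> mp py; apply/asboolP; apply: integral_root_monic py _.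
  by rewrite monic_map.
apply/integral_poly => j; rewrite coef_map.
exact/asboolP/(valP (p`_j : ringInt F)).
Qed.

(** Field morphisms are injective, so the same monic integer polynomial serves on both sides. This
    brings integrality proved in [E] back to [K]. *)
Lemma alg_integer_rmorph (F L : fieldType) (f : {rmorphism F -> L}) (a : F) :
  (f a \in alg_integer L) = (a \in alg_integer F).
Proof.
apply/idP/idP => [|aF]; last exact: (ringInt_map_subproof f (RingInt aF)).
move=> /asboolP[p mp rp]; apply/asboolP; exists p => //.
rewrite -(fmorph_root f) -map_poly_comp.
by rewrite (eq_map_poly (g := intr)) // => z /=; rewrite rmorph_int.
Qed.

(** * Embedding of the integers of [K] into [E], and Galois descent *)

Section Extension.

Variables (K : fieldExtType rat) (E : splittingFieldType K).

Lemma inclEE (a : ringInt K) : inclE E a = in_alg E (ringInt_val a).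
Proof. by []. Qed.

Fact inclE_zmod_morphism : zmod_morphism (@inclE K E).
Proof. by move=> a b; rewrite !inclEE !rmorphB. Qed.

Fact inclE_monoid_morphism : monoid_morphism (@inclE K E).
Proof.
by split=> [|a b]; rewrite !inclEE ?rmorph1 //; apply: (rmorphM (in_alg E)).
Qed.

HB.instance Definition _ :=
  GRing.isZmodMorphism.Build (ringInt K) E (@inclE K E) inclE_zmod_morphism.
HB.instance Definition _ :=
  GRing.isMonoidMorphism.Build (ringInt K) E (@inclE K E)
    inclE_monoid_morphism.

Fact incl_zmod_morphism : zmod_morphism (@incl K E).
Proof. by move=> a b; apply/val_inj/(rmorphB (inclE E)). Qed.

Fact incl_monoid_morphism : monoid_morphism (@incl K E).
Proof.
split=> [|a b]; apply/val_inj; first exact: (rmorph1 (inclE E)).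
exact: (rmorphM (inclE E)).
Qed.

HB.instance Definition _ :=
  GRing.isZmodMorphism.Build (ringInt K) (ringInt E) (@incl K E)
    incl_zmod_morphism.
HB.instance Definition _ :=
  GRing.isMonoidMorphism.Build (ringInt K) (ringInt E) (@incl K E)
    incl_monoid_morphism.

Lemma inclE_inj : injective (@inclE K E).
Proof. by move=> a b; rewrite !inclEE => /fmorph_inj/val_inj. Qed.

Lemma gal_inclE (t : gal_of {:E}) (a : ringInt K) : t (inclE E a) = inclE E a.
Proof. exact: (rmorph_alg t). Qed.

Lemma gal_poly_over (t : gal_of {:E}) (p : {poly K}) :
  map_poly t (map_poly (in_alg E) p) = map_poly (in_alg E) p.
Proof.
rewrite -map_poly_comp; apply: eq_map_poly => a; exact: (rmorph_alg t).
Qed.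

Lemma galois_poly (p : {poly E}) : galois 1 {:E} ->
    {in 'Gal({:E} / 1)%g, forall t : gal_of {:E}, map_poly t p = p} ->
  exists q : {poly K}, map_poly (in_alg E) q = p.
Proof.
move=> /galois_fixedField galE fixp.
have /polyOver1P[q ->] : p \is a polyOver 1%VS by
  apply/polyOverP => j; rewrite -galE; apply/fixedFieldP => [|t tG];
  [exact: memvf | rewrite -[in RHS](fixp t tG) coef_map].
by exists q.
Qed.

(** A divisor over [K] becomes a divisor over [E] with coefficients in [1%VS], to which the
    irreducibility of [minPoly] applies. *)
Lemma minPoly1_irreducible (y : E) :
  exists f : {poly K}, [/\ f \is monic, irreducible_poly f &
    map_poly (in_alg E) f = minPoly 1 y].
Proof.
have /polyOver1P[f fE] := minPolyOver 1%AS y.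
exists f; split=> //.
  by rewrite -(map_monic (in_alg E)) -fE monic_minPoly.
split=> [|q sq qf].
  by rewrite -(size_map_poly (in_alg E)) -fE size_minPoly.
have := @minPoly_irr _ _ 1%AS y (map_poly (in_alg E) q).
rewrite fE dvdp_map => /(_ _ qf)/orP[||].
- by apply/polyOver1P; exists q.
- by rewrite eqp_map.
- by rewrite -size_poly_eq1 size_map_poly (negPf sq).
Qed.

End Extension.

(** * Galois action on [Psi] and integrality of its coefficients times [Delta] *)

Section Psi.

Variables (K : fieldExtType rat) (E : splittingFieldType K).
Variables (d : nat) (C : {poly ringInt K}) (x : 'I_d -> E).
Hypotheses (monicC : C \is monic) (sizeC : size C = d.+1).
Hypotheses (rootsC : map_poly (inclE E) C = \prod_(i < d) ('X - (x i)%:P)).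
Hypotheses (hd : (2 <= d)%N) (injx : injective x).

Lemma root_inclE y : root (map_poly (inclE E) C) y -> exists i, y = x i.
Proof.
rewrite rootsC rootE horner_prod => /eqP/eqP/prodf_eq0[i _].
by rewrite !hornerE subr_eq0 => /eqP->; exists i.
Qed.

Lemma inclE_root i : root (map_poly (inclE E) C) (x i).
Proof.
by rewrite rootsC rootE horner_prod (bigD1 i) //= !hornerE subrr mul0r.
Qed.

Lemma PsiE s :
  Psi C x s = \sum_(i < d) (s (x i) / (nodal x i).[x i]) *: nodal x i.
Proof.
rewrite /Psi rootsC; apply: eq_bigr => i _.
by rewrite divp_nodal deriv_prod_XsubC.
Qed.

(** [t] permutes the roots through some [g], hence the nodal polynomials through the same [g];
    reindex the sum along [g]. *)
Lemma gal_Psi (s t : gal_of {:E}) : map_poly t (Psi C x s) = Psi C x (s ^ t)%g.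
Proof.
have [g tg] : exists g : 'I_d -> 'I_d, forall i, t (x i) = x (g i).
  apply: (@fin_all_exists _ (fun=> 'I_d) (fun i j => t (x i) = x j)) => i.
  apply: root_inclE.
  have <- : map_poly t (map_poly (inclE E) C) = map_poly (inclE E) C.
    by rewrite -map_poly_comp; apply: eq_map_poly => a; apply: gal_inclE.
  by rewrite fmorph_root inclE_root.
have injg : injective g.
  by move=> i j gij; apply/injx/(fmorph_inj t); rewrite /= !tg gij.
rewrite !PsiE raddf_sum [RHS](reindex g) /=; last first.
  by apply: onW_bij; apply: injF_bij.
apply: eq_bigr => i _.
have tN : map_poly t (nodal x i) = nodal x (g i).
  rewrite map_nodal -(nodal_perm _ _ _ _ _ injg).
  by apply: eq_bigr => j _ /=; rewrite tg.
rewrite -mul_polyC rmorphM /= map_polyC /= mul_polyC tN; congr (_ *: _).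
rewrite rmorphM fmorphV -horner_map /= tN tg; congr (_ / _).
(* Products in [gal_of] act from left to right, so [s ^ t] sends [t (x i)] to [t (s (x i))]. *)
have tK : (t^-1)%g (t (x i)) = x i by rewrite -galM ?memvf // mulgV gal_id.
by rewrite /conjg -tg !galM ?memvf // tK.
Qed.

(** Conjugation by [t] stabilizes the class, so [t] only permutes the factors. *)
Lemma gal_Omega (Lambda : {set gal_of {:E}}) (k : nat) :
    Lambda \in classes 'Gal({:E} / 1) ->
  {in 'Gal({:E} / 1)%g, forall t : gal_of {:E},
    map_poly t (Omega C x Lambda k) = Omega C x Lambda k}.
Proof.
move=> /imsetP[s0 _ ->] t tG; rewrite /Omega rmorph_prod /=.
rewrite [RHS](reindex_inj (conjg_inj t)) /=; apply: eq_big => s.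
  by rewrite memJ_norm // (subsetP (class_norm _ _)).
by move=> _; rewrite map_polyXsubC -gal_Psi coef_map.
Qed.

Lemma size_deriv_ringInt : size C^`() = d.
Proof.
apply/eqP; rewrite eqn_leq; apply/andP; split.
  by rewrite -ltnS -sizeC lt_size_deriv // -size_poly_gt0 sizeC.
case: d hd sizeC => // n n2 sC; rewrite ltnNge; apply/negP => sn.
(* This coefficient is [n.+1], which is nonzero in characteristic 0. *)
have : C^`()`_n = 0 by rewrite nth_default.
rewrite coef_deriv; have := monicP monicC; rewrite lead_coefE sC /= => ->.
move/(congr1 (inclE E))/eqP; rewrite rmorph_nat rmorph0.
have pE : [pchar E] =i pred0.
  by move=> p; rewrite !pchar_lalg Num.Theory.pchar_num.
by have /pcharf0P-> := pE.
Qed.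

(** Simple roots make [C] separable over [E], hence coprime to its derivative, so the resultant does
    not vanish. *)
Lemma discriminant_neq0 : inclE E (discriminant C) != 0.
Proof.
rewrite /discriminant rmorphM rmorphXn rmorphN1 mulf_neq0 ?signr_eq0 //=.
rewrite rmorph_resultant; last first.
- rewrite raddf_eq0; last exact: inclE_inj.
  by rewrite lead_coef_eq0 -size_poly_gt0 size_deriv_ringInt ltnW.
- by rewrite (monicP monicC) rmorph1 oner_eq0.
rewrite -deriv_map resultant_eq0 -leqNgt.
have : separable_poly (map_poly (inclE E) C).
  have -> : map_poly (inclE E) C =
      \prod_(a <- [seq x i | i : 'I_d]) ('X - a%:P).
    by rewrite rootsC big_image.
  by rewrite separable_prod_XsubC map_inj_uniq // enum_uniq.
by rewrite unlock /coprimep => /eqP->.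
Qed.

Lemma alg_integer_roots i : x i \in alg_integer E.
Proof.
apply: (@alg_integer_root _ (map_poly (@incl K E) C)); first exact: monic_map.
by rewrite -map_poly_comp; apply: inclE_root.
Qed.

Let y i : ringInt E := RingInt (alg_integer_roots i).

(* Evaluate the Bezout identity [Delta = u C + v C'] at [x i]. *)
Lemma discriminant_div_nodal : exists v : 'I_d -> ringInt E,
  forall i, inclE E (discriminant C) / (nodal x i).[x i] = ringInt_val (v i).
Proof.
have [||[u v] /= _ uv] := @resultant_in_ideal _ C C^`().
- by rewrite sizeC ltnS ltnW.
- by rewrite size_deriv_ringInt.
pose sg : ringInt K := (-1) ^+ 'C((size C).-1, 2).
exists (fun i => incl E sg * (map_poly (@incl K E) v).[y i]) => i.
apply: (canLR (mulfK (nodal_neq0 _ _ _ injx i))).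
rewrite /discriminant -/sg rmorphM [in RHS]rmorphM -mulrA /=.
congr (_ * _).
have /(congr1 (fun q => (map_poly (inclE E) q).[x i])) := uv.
rewrite map_polyC hornerC /= => ->.
rewrite rmorphD !rmorphM /= hornerD !hornerM (eqP (inclE_root i)) mulr0 add0r.
rewrite -deriv_map rootsC deriv_prod_XsubC; congr (_ * _).
by rewrite -horner_map -map_poly_comp.
Qed.

(** The weights [W] do not depend on the interpolated values [b]. They serve both [Psi], with
    [b i = s (x i)], and the remainder of [X^p], with [b i = x i ^ p], so the two can be compared
    term by term. *)
Lemma integral_Psi : exists W : 'I_d -> nat -> ringInt E,
  forall b : 'I_d -> ringInt E, forall k,
  inclE E (discriminant C) *
    (\sum_(i < d) (ringInt_val (b i) / (nodal x i).[x i]) *: nodal x i)`_k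
  = ringInt_val (\sum_(i < d) b i * W i k).
Proof.
have [v vE] := discriminant_div_nodal.
exists (fun i k => v i * (nodal y i)`_k) => b k.
rewrite coef_sum mulr_sumr rmorph_sum; apply: eq_bigr => i _.
rewrite coefZ 2![in RHS]rmorphM /= -vE -coef_map map_nodal.
by rewrite !mulrA [_ * ringInt_val (b i)]mulrC.
Qed.

End Psi.

(** * Integrality, irreducible factor and Frobenius congruence for [Omega] *)

Theorem theorem24 (K : fieldExtType rat) (E : splittingFieldType K)
    (d : nat) (C : {poly ringInt K}) (x : 'I_d -> E)
    (galE : galois 1 {:E})
    (hd : (2 <= d)%N)
    (monicC : C \is monic)
    (sizeC : size C = d.+1)
    (rootsC : map_poly (inclE E) C = \prod_(i < d) ('X - (x i)%:P))
    (simpleC : injective x)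
    (splitC : splittingFieldFor 1 (map_poly (inclE E) C) {:E})
    (Lambda : {set gal_of {:E}})
    (classL : Lambda \in classes 'Gal({:E} / 1))
    (k : 'I_d) :
  let Delta := discriminant C in
  let lambda := #|Lambda| in
  let Om := Omega C x Lambda k in
  [/\ [/\ size Om = lambda.+1,
          (forall j, in_adjoin_inv Delta Om`_j) &
          exists F : {poly ringInt K},
            inclE E Delta ^+ lambda *: Om = map_poly (inclE E) F],
      (exists OmK : {poly K},
         map_poly (in_alg E) OmK = Om /\
         (irreducible_poly OmK \/
          exists (f : {poly K}) (n : nat),
            [/\ irreducible_poly f, (0 < n)%N & OmK = f ^+ n])) &
      forall P : prime_idealr (ringInt K), Frob_primes C Lambda P ->
        let p := ideal_norm P in
        let r := Pdiv.Ring.rmodp 'X^p C in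
        (forall U : nat -> ringInt K, class_seq C U ->
           U p = \sum_(j < d) r`_j * U j) /\
        exists2 a : ringInt K,
          a \in P &
          inclE E a = inclE E Delta ^+ lambda * Om.[inclE E r`_k]].
Proof.
move=> Delta lambda Om.
have D0 : inclE E Delta != 0 :=
  discriminant_neq0 _ _ _ _ _ monicC sizeC rootsC hd simpleC.
have [W] := integral_Psi _ _ _ _ _ monicC sizeC rootsC hd simpleC.
(* [Delta] must become opaque: unification would unfold its determinant. *)
rewrite -/Delta => WE; clearbody Delta; set iD := inclE E Delta in D0 WE *.
pose y i : ringInt E := RingInt (alg_integer_roots _ _ _ _ _ monicC rootsC i).
pose psi s := \sum_(i < d) gal_ringInt s (y i) * W i k.
have psiE s : iD * (Psi C x s)`_k = ringInt_val (psi s).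
  by rewrite (PsiE _ _ _ _ _ rootsC) -WE.
have sOm : size Om = lambda.+1.
  by rewrite /Om /Omega -big_enum size_prod_XsubC -cardE.
have [OmK OmE] : exists OmK : {poly K}, map_poly (in_alg E) OmK = Om.
  apply: galois_poly => // t tG.
  exact: (gal_Omega _ _ _ _ _ rootsC simpleC).
(* One [Delta] goes to each of the [lambda] factors, which makes every factor integral. *)
pose FB : {poly ringInt E} :=
  \prod_(s in Lambda) ((incl E Delta) *: 'X - (psi s)%:P).
have FBE : iD ^+ lambda *: Om = map_poly (@ringInt_val E) FB.
  rewrite rmorph_prod /= -prodr_const -scaler_prod; apply: eq_bigr => s _.
  rewrite rmorphB /= map_polyZ map_polyX map_polyC /= -psiE.
  by rewrite polyCM mul_polyC scalerBr.
have [F FE] : exists F : {poly ringInt K},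
    iD ^+ lambda *: Om = map_poly (inclE E) F.
  (* The coefficients lie in [K] by descent and are integral in [E] by [FB], so they are integers of
     [K]. *)
  have [|F FE] := @ringInt_poly_lift K ((ringInt_val Delta) ^+ lambda *: OmK).
    move=> j; rewrite -(alg_integer_rmorph _ _ (in_alg E)) coefZ.
    rewrite rmorphM rmorphXn -coef_map /= OmE.
    change (iD ^+ lambda * Om`_j \in alg_integer E).
    by rewrite -coefZ FBE coef_map; apply: valP.
  exists F; rewrite -OmE.
  have -> : iD ^+ lambda = in_alg E (ringInt_val Delta ^+ lambda).
    by rewrite rmorphXn.
  rewrite -mul_polyC -(map_polyC (in_alg E)) -rmorphM /= mul_polyC -FE.
  by rewrite -map_poly_comp.
have OmF j : Om`_j = inclE E F`_j * iD^-1 ^+ lambda.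
  by rewrite -coef_map -FE coefZ mulrAC exprVn mulfV ?mul1r ?expf_neq0.
split; first split=> //.
- move=> j; exists (F`_j *: 'X^lambda).
  by rewrite OmF -mul_polyC rmorphM /= map_polyC map_polyXn !hornerE.
- by exists F.
(* The irreducible case is included as exponent 1. *)
- exists OmK; split=> //; right.
  have /imsetP[s0 s0G LE] := classL.
  have [f [mf irrf fE]] := @minPoly1_irreducible K E (Psi C x s0)`_k.
  have [//|//|||n OmKn] := @power_of_irreducible _ _ (in_alg E) f OmK
    [seq (Psi C x s)`_k | s in Lambda].
  + by rewrite OmE big_image.
  (* Each root is a Galois conjugate of the one at [s0], and [f] has coefficients in [K]. *)
  + move=> _ /mapP[s sL ->]; move: sL; rewrite mem_enum LE => /imsetP[t tG ->].
    rewrite -(gal_Psi _ _ _ _ _ rootsC simpleC) coef_map -(gal_poly_over _ _ t).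
    by rewrite fmorph_root fE root_minPoly.
  have lambda_gt0 : (0 < lambda)%N.
    by apply/card_gt0P; exists s0; rewrite LE class_refl.
  exists f, n; split=> //; rewrite lt0n; apply: contraTneq lambda_gt0 => n0.
  by rewrite -ltnS -sOm -OmE size_map_poly OmKn n0 expr0 size_poly1.
move=> P [_ _ [Q [QP [s sL frob]]]] p r; split.
  by move=> U CU; apply: class_seq_rmodp.
exists F.[r`_k]; last by rewrite -hornerZ FE horner_map.
(* Since [Q] lies above [P], membership can be tested in [Q], where [FB] factors. *)
rewrite -QP.
have -> : incl E F.[r`_k] = FB.[incl E r`_k].
  apply: (val_inj : injective (@ringInt_val E)).
  rewrite -[RHS]horner_map -FBE FE; exact: (esym (horner_map (inclE E) F r`_k)).
(* It suffices that the factor of the Frobenius [s] lies in [Q]. *)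
rewrite horner_prod (bigD1 s) //= mulrC idealMr // !hornerE.
have sr : (size (map_poly (inclE E) r) <= d)%N.
  rewrite (leq_trans (size_poly _ _)) //.
  by rewrite -ltnS -sizeC Pdiv.Ring.ltn_rmodp monic_neq0.
have rx i : (map_poly (inclE E) r).[x i] = ringInt_val (y i ^+ p).
  have /(congr1 (fun q => (map_poly (inclE E) q).[x i])) :=
    Pdiv.RingMonic.rdivp_eq monicC 'X^p.
  rewrite map_polyXn hornerXn rmorphD rmorphM hornerD hornerM.
  by rewrite (eqP (inclE_root _ _ _ _ _ rootsC i)) mulr0 add0r rmorphXn => <-.
have interp : map_poly (inclE E) r =
    \sum_(i < d) (ringInt_val (y i ^+ p) / (nodal x i).[x i]) *: nodal x i.
  by rewrite {1}(lagrange _ _ _ simpleC _ sr); under eq_bigr do rewrite rx.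
have -> : incl E Delta * incl E r`_k = \sum_(i < d) y i ^+ p * W i k.
  apply: (val_inj : injective (@ringInt_val E)).
  by rewrite -WE -interp coef_map rmorphM.
(* With common weights, each term is a multiple of [x i ^ p - s (x i)], which the Frobenius
   congruence puts in [Q]. *)
rewrite -sumrB rpred_sum // => i _; rewrite -mulrBl mulrC idealMr //.
by rewrite -opprB rpredN frob.
Qed.
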